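(* Let $\mathcal{I}$ be an ideal on $\omega$ and let $\mathscr{A}$ be a nonempty family of infinite real matrices $A=(a_{n,k}:n,k\in\omega)$ such that $\sup\{\|A\|:A\in\mathscr{A}\}<\infty$, where $\|A\|:=\sup_n\sum_k|a_{n,k}|$. Then $$\forall\bm{x}\in\ell_\infty,\quad\limsup_{n\to\infty}\ \sup_{A\in\mathscr{A}}A_n\bm{x}\le\mathcal{I}\text{-}\limsup\bm{x}$$ if and only if all of the following hold: (L1) $\lim_n\sum_{k\in E}|a_{n,k}|=0$ uniformly on $A\in\mathscr{A}$, for all $E\in\mathcal{I}$; (L2) $\lim_n\sum_ka_{n,k}=1$ uniformly on $A\in\mathscr{A}$; (L3) $\lim_n\sum_k|a_{n,k}|=1$ uniformly on $A\in\mathscr{A}$.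
   Context: $\omega=\{0,1,2,\ldots\}$; $\ell_\infty$ is the space of bounded real sequences. For a real matrix $A=(a_{n,k})$ with $\|A\|<\infty$ and $\bm{x}=(x_k)\in\ell_\infty$, $A_n\bm{x}:=\sum_ka_{n,k}x_k$. In (L1)–(L3), $a_{n,k}$ denotes the entries of $A\in\mathscr{A}$, and ''uniformly on $A\in\mathscr{A}$'' means that for every $\varepsilon>0$ there is $n_0$ (independent of $A$) such that the quantity is within $\varepsilon$ of the limit for all $n\ge n_0$ and all $A\in\mathscr{A}$. An ideal on $\omega$ is a family $\mathcal{I}$ of subsets of $\omega$ closed under finite unions and subsets; it is always assumed that $\omega\notin\mathcal{I}$ and that $\mathcal{I}$ contains all finite subsets of $\omega$. For a bounded real sequence $\bm{x}=(x_n)$, a real $\eta$ is an $\mathcal{I}$-cluster point of $\bm{x}$ if $\{n\in\omega:|x_n-\eta|\le\varepsilon\}\notin\mathcal{I}$ for all $\varepsilon>0$. The set $\Gamma_{\bm{x}}(\mathcal{I})$ of $\mathcal{I}$-cluster points is nonempty and compact, and $\mathcal{I}\text{-}\limsup\bm{x}:=\max\Gamma_{\bm{x}}(\mathcal{I})$. *)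

(* Defs.v *)
From HB Require Import structures.
From mathcomp Require Import all_boot all_order all_algebra.
From mathcomp Require Import all_classical all_reals all_analysis.
From mathcomp Require Import lra.

Set Implicit Arguments.
Unset Strict Implicit.
Unset Printing Implicit Defensive.

Import Order.TTheory GRing.Theory Num.Theory.
Import numFieldNormedType.Exports.

Local Open Scope classical_set_scope.
Local Open Scope ring_scope.

(* Series in a realType; the library only has these notations in
   ereal_scope. A divergent series has an arbitrary value. *)
Notation "\sum_ ( i <oo | P ) F" :=
  (\big[+%R/0%R]_(0 <= i <oo | P%B) F%R) : ring_scope.
Notation "\sum_ ( i <oo ) F" :=
  (\big[+%R/0%R]_(0 <= i <oo) F%R) : ring_scope.

Record is_ideal (I : set (set nat)) : Prop := IsIdeal {
  ideal_sub : forall E F : set nat, E `<=` F -> I F -> I E;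
  ideal_setU : forall E F : set nat, I E -> I F -> I (E `|` F);
  ideal_finite : forall E : set nat, finite_set E -> I E;
  ideal_proper : ~ I [set: nat] }.

Section Definitions.
Context {R : realType}.
Implicit Types (I : set (set nat)) (x : nat -> R) (A : nat -> nat -> R).

Definition Icluster I x : set R :=
  [set eta | forall e, 0 < e -> ~ I [set n | `|x n - eta| <= e]].

(* The maximum of the set of cluster points: it exists for bounded x
   (Ilimsup_max), so the default value 0 is never used there. *)
Definition Ilimsup I x : R :=
  xget 0 [set m | Icluster I x m /\ ubound (Icluster I x) m].

(* Extended-real valued, so that infmx_norm A < +oo is a genuine condition. *)
Definition infmx_norm A : \bar R :=
  ereal_sup [set (\sum_(k <oo) `|A n k|%:E)%E | n in [set: nat]].

(* Absolutely convergent when infmx_norm A < +oo and x is bounded. *)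
Definition infmx_app A (n : nat) x : R := \sum_(k <oo) (A n k * x k).

Definition unif_lim (Fam : set (nat -> nat -> R))
    (q : (nat -> nat -> R) -> nat -> R) (l : R) : Prop :=
  forall e, 0 < e -> exists n0 : nat, forall n, (n0 <= n)%N ->
    forall A, Fam A -> `|q A n - l| <= e.

Lemma Ilimsup_max I x : is_ideal I -> bounded_fun x ->
  Icluster I x (Ilimsup I x) /\ ubound (Icluster I x) (Ilimsup I x).
Proof.
move=> [Isub IU Ifin Iprop] /pinfty_ex_gt0 [M _ xM].
have {}xM n : - M <= x n <= M by rewrite -ler_norml; exact: xM.
pose S := [set t | ~ I [set n | t <= x n]].
have supS : has_sup S.
  split; first exists (- M).
    rewrite /S /=; suff -> : [set n | - M <= x n] = setT by [].
    by apply/seteqP; split => // n _ /=; case/andP: (xM n).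
  exists M => t /= St; rewrite leNgt; apply/negP => Mt; apply: St.
  apply: Isub (Ifin _ (finite_set0 _)) => n /= tx.
  by have := xM n; lra.
have above t : sup S < t -> I [set n | t <= x n].
  move=> St; apply: contrapT => It.
  by have := @sup_upper_bound _ _ supS t It; lra.
suff : exists m, Icluster I x m /\ ubound (Icluster I x) m by move/(xgetPex 0).
exists (sup S); split.
  move=> e e0 Ie.
  have [t St tS] := @sup_adherent _ S e e0 supS.
  have Ia : I [set n | sup S + e <= x n] by apply: above; lra.
  apply: St; apply: Isub (IU _ _ Ie Ia) => n /= tx.
  have [ex|ex] := leP (sup S + e) (x n); first by right.
  by left; rewrite /= ler_norml; apply/andP; split; lra.
move=> eta Ceta; rewrite leNgt; apply/negP => Seta.
have e0 : 0 < (eta - sup S) / 2 by lra.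
apply: (Ceta _ e0).
have Ia : I [set n | (eta + sup S) / 2 <= x n] by apply: above; lra.
by apply: Isub Ia => n /=; rewrite ler_norml => /andP[]; lra.
Qed.

End Definitions.

(* Main.v *)
(* Sufficiency: for t slightly above the I-limsup of x, the set
   E = {k : t <= x_k} is in I, and for K bounding |x_k - t| one has termwise
   a_k (x_k - t) <= K (|a_k| - a_k) + K |a_k| 1_E(k); sum over k and use
   (L1)-(L3).
   Necessity: x = 1 and x = -1 give (L2), and x = +-delta_k shows that every
   column tends to 0 uniformly. A gliding hump argument then turns a uniform
   bound c on limsup A_n x, for all |x| <= 1 supported in E, into the same
   bound for limsup sum_(k in E) |a_(n,k)|: (L1) is the case E in I, c = 0, and
   (L3) the case E = omega, c = 1. *)
Require Import Defs.
From HB Require Import structures.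
From mathcomp Require Import all_boot all_order all_algebra.
From mathcomp Require Import all_classical all_reals all_analysis.
From mathcomp Require Import ring lra.
Set Implicit Arguments.
Unset Strict Implicit.

Import Order.TTheory GRing.Theory Num.Theory.
Import numFieldNormedType.Exports.

Local Open Scope classical_set_scope.
Local Open Scope ring_scope.

(** * Dominated, truncated and nearly concentrated series *)

Lemma cvg_series_dominated (R : realType) (f g : nat -> R) :
  (forall k, `|f k| <= g k) -> cvgn (series g) -> cvgn (series f).
Proof.
move=> fg cg; apply: normed_cvg; apply: (series_le_cvg _ _ fg cg) => k //=.
exact: le_trans (fg k).
Qed.

Lemma lim_series_lin (R : realType) (f g : nat -> R) (a : R) :
  cvgn (series f) -> cvgn (series g) ->
  limn (series (fun k => f k + a * g k)) =
  limn (series f) + a * limn (series g).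
Proof.
move=> cf cg; rewrite -[a * limn _]/(a *: limn _) -lim_seriesZ//.
by rewrite -lim_seriesD//; exact: is_cvg_seriesZ.
Qed.

Lemma cvg_series_lin (R : realType) (f g : nat -> R) (a : R) :
  cvgn (series f) -> cvgn (series g) ->
  cvgn (series (fun k => f k + a * g k)).
Proof. by move=> cf cg; apply: is_cvg_seriesD => //; exact: is_cvg_seriesZ. Qed.

Lemma series_le_lim (R : realType) (f : nat -> R) (n : nat) :
  (forall k, 0 <= f k) -> cvgn (series f) ->
  \sum_(0 <= k < n) f k <= limn (series f).
Proof.
move=> f0 cf; apply: (nondecreasing_cvgn_le _ cf n).
by apply: nondecreasing_series.
Qed.

Lemma series_partial_near_lim (R : realType) (f : nat -> R) (m : nat) (d : R) :
  cvgn (series f) -> 0 < d ->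
  exists2 p, (m < p)%N & limn (series f) - \sum_(0 <= k < p) f k <= d.
Proof.
move=> cf d0; have [N _ NP] := cvgr_dist_le _ _ cf _ d0.
exists (maxn m.+1 N); first by rewrite leq_maxl.
apply: le_trans (ler_norm _) _; apply: NP; exact: leq_maxr.
Qed.

(** The two series agree termwise on the block [m <= k < p]. Off the block their terms differ by at
    most [2 * |a k|], and head and tail each carry mass at most [d], so the loss is at most
    [2 * d + 2 * d]. *)
Lemma lim_series_concentrated (R : realType) (E : set nat) (a x : nat -> R)
    (m p : nat) (d : R) :
  cvgn (series (fun k => `|a k|)) -> (forall k, `|x k| <= 1) -> (m <= p)%N ->
  (forall k, (m <= k < p)%N -> a k * x k = `|a k| * \1_E k) ->
  \sum_(0 <= k < m) `|a k| <= d ->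
  limn (series (fun k => `|a k|)) - \sum_(0 <= k < p) `|a k| <= d ->
  limn (series (fun k => `|a k| * \1_E k)) - 4 * d <=
  limn (series (fun k => a k * x k)).
Proof.
move=> ca x1 mp axE headd taild.
have ind01 k : 0 <= (\1_E k : R) <= 1.
  by rewrite indicE; case: (k \in E) => /=; rewrite ?lexx ?ler01.
have cE : cvgn (series (fun k => `|a k| * \1_E k)).
  apply: cvg_series_dominated ca => k.
  have /andP[i0 i1] := ind01 k.
  by rewrite normrM normr_id (ger0_norm i0) ler_piMr.
have cx : cvgn (series (fun k => a k * x k)).
  by apply: cvg_series_dominated ca => k; rewrite normrM ler_piMr.
have h2 k : `|a k| * \1_E k + (-1) * (a k * x k) <= 2 * `|a k|.
  have /andP[i0 i1] := ind01 k.
  have u : `|a k| * \1_E k <= `|a k| by rewrite ler_piMr.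
  have v : `|a k * x k| <= `|a k| by rewrite normrM ler_piMr.
  by move: v; rewrite ler_norml => /andP[]; lra.
suff : limn (series (fun k => `|a k| * \1_E k + (-1) * (a k * x k))) <= 4 * d.
  by rewrite lim_series_lin//; lra.
apply: limr_le; first exact: cvg_series_lin.
exists p => // N /= pN; rewrite /series/=.
rewrite (@big_cat_nat _ _ _ p)//= (@big_cat_nat _ _ _ m 0 p)//=.
have -> : \sum_(m <= k < p) (`|a k| * \1_E k + (-1) * (a k * x k)) = 0.
  by rewrite big_nat big1// => k mkp; rewrite axE//; lra.
have hd : \sum_(0 <= k < m) (`|a k| * \1_E k + (-1) * (a k * x k)) <= 2 * d.
  apply: (@le_trans _ _ (2 * \sum_(0 <= k < m) `|a k|)); last lra.
  by rewrite mulr_sumr; apply: ler_sum.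
have tl : \sum_(p <= k < N) (`|a k| * \1_E k + (-1) * (a k * x k)) <= 2 * d.
  apply: (@le_trans _ _ (2 * \sum_(p <= k < N) `|a k|)).
    by rewrite mulr_sumr; apply: ler_sum.
  have := @series_le_lim _ (fun k => `|a k|) N (fun k => normr_ge0 _) ca.
  by rewrite (@big_cat_nat _ _ _ p)//=; lra.
lra.
Qed.

(** * Upper limits that are uniform over the family *)

Definition unif_limsup_le {R : realType} (Fam : set (nat -> nat -> R))
    (q : (nat -> nat -> R) -> nat -> R) (l : R) : Prop :=
  forall e, 0 < e -> exists n0 : nat, forall n, (n0 <= n)%N ->
    forall A, Fam A -> q A n <= l + e.

(** The upper limit is the infimum of the tail suprema, and a tail supremum of suprema over [Fam]
    bounds all late rows of all matrices at once. This trades extended reals for real estimates. *)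
Lemma unif_limsup_leP (R : realType) (Fam : set (nat -> nat -> R))
    (q : (nat -> nat -> R) -> nat -> R) (l : R) :
  (limn_esup (fun n => ereal_sup [set (q A n)%:E | A in Fam]) <= l%:E)%E <->
  unif_limsup_le Fam q l.
Proof.
set u := fun n => ereal_sup _.
have -> : limn_esup u = ereal_inf (range (esups u)).
  by rewrite limn_esup_lim; apply/cvg_lim => //; exact: cvg_esups_inf.
split=> [ul e e0|H].
  have : (ereal_inf (range (esups u)) < (l + e)%:E)%E.
    by apply: le_lt_trans ul _; rewrite lte_fin; lra.
  move=> /ereal_inf_lt[_ [N _ <-] uN]; exists N => n Nn A FA.
  rewrite -lee_fin; apply: le_trans (ltW uN).
  apply: (@le_trans _ _ (u n)); apply: ereal_sup_ubound; first by exists A.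
  by exists n.
apply/lee_addgt0Pr => e e0; have [N NP] := H e e0.
apply: (@le_trans _ _ (esups u N)); first by apply: ereal_inf_lbound; exists N.
apply: ge_ereal_sup => _ [n /= Nn <-]; apply: ge_ereal_sup => _ [A FA <-].
by rewrite -EFinD lee_fin; exact: NP.
Qed.

(** * The gliding hump *)

Lemma unif_columns (R : realType) (Fam : set (nat -> nat -> R)) :
  (forall k, unif_limsup_le Fam (fun A n => `|A n k|) 0) ->
  forall m, unif_limsup_le Fam (fun A n => \sum_(0 <= k < m) `|A n k|) 0.
Proof.
move=> col; elim=> [|m IH] e e0.
  by exists 0 => n _ A _; rewrite big_geq//; lra.
have e20 : 0 < e / 2 by lra.
have [N1 H1] := IH _ e20; have [N2 H2] := col m _ e20.
exists (maxn N1 N2) => n; rewrite geq_max => /andP[n1 n2] A FA.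
rewrite big_nat_recr//=.
by have := H1 n n1 A FA; have := H2 n n2 A FA; lra.
Qed.

(* Gliding hump: if the conclusion fails along rows r_0, r_1, ..., passing to
   sparser rows makes r_i almost concentrated on disjoint blocks; the
   sequence x equal to sgn r_i on the i-th block then contradicts the
   hypothesis. *)
Lemma gliding_hump (R : realType) (Fam : set (nat -> nat -> R))
    (E : set nat) (c : R) :
  (forall A n, Fam A -> cvgn (series (fun k => `|A n k|))) ->
  (forall k, unif_limsup_le Fam (fun A n => `|A n k|) 0) ->
  (forall x : nat -> R, (forall k, `|x k| <= 1) ->
     (forall k, ~ E k -> x k = 0) ->
     unif_limsup_le Fam (fun A n => infmx_app A n x) c) ->
  unif_limsup_le Fam
    (fun A n => limn (series (fun k => `|A n k| * \1_E k))) c.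
Proof.
move=> summ col test e e0; apply: contrapT => nH.
(* Concentration will cost [4 * d = e / 2] and the test sequence is used with tolerance [e / 4];
   together they stay below the excess [e]. *)
pose d := e / 8; have d0 : 0 < d by rewrite /d; lra.
(* The state [s] holds the first admissible row and the start of the block; [r] holds a matrix, a
   row of it that violates the bound, and the end of the block. *)
pose good (s : nat * nat) (r : (nat -> nat -> R) * nat * nat) :=
  let: (A, n, p) := r in
  [/\ (s.1 <= n)%N, (s.2 < p)%N /\ Fam A,
      c + e < limn (series (fun k => `|A n k| * \1_E k)),
      \sum_(0 <= k < s.2) `|A n k| <= d
    & limn (series (fun k => `|A n k|)) - \sum_(0 <= k < p) `|A n k| <= d].
(* Violating rows occur arbitrarily late, hence also where the mass before the block is already
   uniformly small; the block end is then chosen to cut off the tail. *)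
have step s : exists r, good s r.
  have [N NP] := unif_columns col s.2 d0.
  have : ~ forall n, (maxn s.1 N <= n)%N -> forall A, Fam A ->
      limn (series (fun k => `|A n k| * \1_E k)) <= c + e.
    by move=> H; apply: nH; exists (maxn s.1 N).
  move=> /existsNP[n /not_implyP[sn /existsNP[A /not_implyP[FA /negP]]]].
  rewrite -ltNge => big; move: sn; rewrite geq_max => /andP[sn Nn].
  have [p sp pd] := series_partial_near_lim s.2 (summ A n FA) d0.
  exists (A, n, p); split => //.
  by have := NP n Nn A FA; rewrite add0r.
have [f fP] := choice step.
(* The successor on the row forces the chosen rows to increase, hence [i <= n i]; each block starts
   where the previous one ends. *)
pose s := fix s i := if i is j.+1 then ((f (s j)).1.2.+1, (f (s j)).2)
                     else (0, 0)%N.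
pose B i := (f (s i)).1.1; pose n i := (f (s i)).1.2; pose m i := (s i).2.
have sP i : [/\ ((s i).1 <= n i)%N, (m i < m i.+1)%N /\ Fam (B i),
      c + e < limn (series (fun k => `|B i (n i) k| * \1_E k)),
      \sum_(0 <= k < m i) `|B i (n i) k| <= d
    & limn (series (fun k => `|B i (n i) k|)) -
      \sum_(0 <= k < m i.+1) `|B i (n i) k| <= d].
  by have := fP (s i); rewrite /B /n /m /=; case: (f (s i)) => [[A q] p].
have n_ge i : (i <= n i)%N.
  elim: i => // i IH; have [+ _ _ _ _] := sP i.+1.
  by apply: leq_trans; rewrite /= ltnS.
have m_mono : {homo m : i j / (i <= j)%N}.
  by apply: homo_leq => [//|j i k|i]; [exact: leq_trans|have [_ [/ltnW]] := sP i].
(* The blocks partition the indices, since [m] starts at 0 and strictly increases; the default 0 is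
   never taken. *)
pose block k := xget 0%N [set i | (m i <= k < m i.+1)%N].
have blockE i k : (m i <= k < m i.+1)%N -> block k = i.
  move=> mik; apply: xget_unique => // j /= /andP[mj mj1].
  case/andP: mik => mi mi1; apply/eqP; rewrite eqn_leq -ltnS -[X in _ && X]ltnS.
  apply/andP; split; rewrite ltnNge; apply/negP => /m_mono mm.
    by have := leq_trans (leq_ltn_trans mj mi1) mm; rewrite ltnn.
  by have := leq_trans (leq_ltn_trans mi mj1) mm; rewrite ltnn.
pose x k : R := Num.sg (B (block k) (n (block k)) k) * \1_E k.
have x1 k : `|x k| <= 1.
  rewrite /x normrM normr_sg indicE.
  by case: (_ == _); case: (k \in E); rewrite /= ?normr1 ?normr0; lra.
have xE k : ~ E k -> x k = 0 by move=> nE; rewrite /x indicE memNset// mulr0.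
have e40 : 0 < e / 4 by lra.
have [N NP] := test x x1 xE _ e40.
have [_ [mm FB] big hd tl] := sP N.
have := NP (n N) (n_ge N) (B N) FB.
have : limn (series (fun k => `|B N (n N) k| * \1_E k)) - 4 * d <=
    infmx_app (B N) (n N) x.
  apply: (lim_series_concentrated (summ _ _ FB) x1 (ltnW mm) _ hd tl).
  move=> k /blockE kN; rewrite /x kN mulrA; congr (_ * _).
  by rewrite normrEsg mulrC.
rewrite /d; lra.
Qed.

(** * Level sets and the ideal upper limit; summability of rows *)

Lemma Ilimsup_le (R : realType) (I : set (set nat)) (x : nat -> R) (c : R) :
  is_ideal I -> bounded_fun x -> I [set k | c < x k] -> Ilimsup I x <= c.
Proof.
move=> HI bx Ic; have [Lc _] := Ilimsup_max HI bx.
rewrite leNgt; apply/negP => cL.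
have e0 : 0 < (Ilimsup I x - c) / 2 by lra.
apply: (Lc _ e0); apply: (ideal_sub HI _ Ic) => k /=.
by rewrite ler_norml => /andP[]; lra.
Qed.

(** Otherwise the supremum of all levels [r] with [{r <= x}] outside [I] is at least [t]. It is a
    cluster point: just below it the level set is outside [I], just above it inside. This
    contradicts maximality of [Ilimsup I x]. *)
Lemma ideal_above_Ilimsup (R : realType) (I : set (set nat)) (x : nat -> R)
    (t : R) :
  is_ideal I -> bounded_fun x -> Ilimsup I x < t -> I [set k | t <= x k].
Proof.
move=> HI bx Lt; apply: contrapT => It.
have [_ Lmax] := Ilimsup_max HI bx.
have [M [_ xM]] : exists M, 0 < M /\ forall k, `|x k| <= M.
  move: bx => /pinfty_ex_gt0 [M M0 xM]; exists M; split => // k; exact: xM.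
pose S := [set r | ~ I [set k | r <= x k]].
have supS : has_sup S.
  split; first by exists t.
  exists M => r /= Sr; rewrite leNgt; apply/negP => Mr; apply: Sr.
  apply: (ideal_sub HI _ (ideal_finite HI (finite_set0 _))) => k /= rx.
  by have := xM k; rewrite ler_norml => /andP[]; lra.
have tS : t <= sup S by apply: sup_upper_bound.
suff /Lmax : Icluster I x (sup S) by lra.
move=> e e0 Ie; have [r Sr rS] := @sup_adherent _ S e e0 supS.
have Ia : I [set k | sup S + e <= x k].
  apply: contrapT => Sa.
  by have := @sup_upper_bound _ _ supS (sup S + e) Sa; lra.
apply: Sr; apply: (ideal_sub HI _ (ideal_setU HI Ie Ia)) => k /= rx.
have [ex|ex] := leP (sup S + e) (x k); first by right.
by left; rewrite /= ler_norml; apply/andP; split; lra.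
Qed.

Lemma infmx_norm_summable (R : realType) (A : nat -> nat -> R) (n : nat) :
  (infmx_norm A < +oo)%E -> cvgn (series (fun k => `|A n k|)).
Proof.
move=> Aoo; have : (\sum_(k <oo) `|A n k|%:E < +oo)%E.
  by apply: le_lt_trans Aoo; apply: ereal_sup_ubound; exists n.
set s := (X in (X < _)%E) => soo.
have s0 : (0 <= s)%E by apply: nneseries_ge0.
have sfin : s \is a fin_num by rewrite ge0_fin_numE.
apply: nondecreasing_is_cvgn; first by apply: nondecreasing_series.
exists (fine s) => _ [N _ <-]; rewrite -lee_fin fineK// /series/= -sumEFin.
exact: nneseries_lim_ge.
Qed.

Lemma bounded_by (R : realType) (x : nat -> R) (M : R) :
  (forall k, `|x k| <= M) -> bounded_fun x.
Proof.
move=> xM; exists M; split; first exact: num_real.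
by move=> N MN k _; apply: le_trans (xM k) (ltW MN).
Qed.

Section RegularFamily.
Context {R : realType} {I : set (set nat)} {Fam : set (nat -> nat -> R)}.
Hypotheses (HI : is_ideal I)
  (summ : forall A n, Fam A -> cvgn (series (fun k => `|A n k|))).

(** * Sufficiency of (L1)-(L3) *)

Lemma limsup_le_of_unif_lim :
  (forall E, I E ->
     unif_lim Fam (fun A n => limn (series (fun k => `|A n k| * \1_E k))) 0) ->
  unif_lim Fam (fun A n => limn (series (A n))) 1 ->
  unif_lim Fam (fun A n => limn (series (fun k => `|A n k|))) 1 ->
  forall x, bounded_fun x ->
    unif_limsup_le Fam (fun A n => infmx_app A n x) (Ilimsup I x).
Proof.
move=> L1 L2 L3 x bx e e0; set L := Ilimsup I x.
have [M [M0 xM]] : exists M, 0 < M /\ forall k, `|x k| <= M.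
  by move: bx => /pinfty_ex_gt0 [M M0 xM]; exists M; split => // k; exact: xM.
(* [K] dominates both [|x k - t|] and [|t|], and is positive. *)
pose t := L + e / 2; pose K := M + `|t| + 1.
have Kt : `|t| + 1 <= K by rewrite /K; lra.
have K0 : 0 < K by have := normr_ge0 t; lra.
pose E := [set k | t <= x k].
have IE : I E by apply: ideal_above_Ilimsup => //; rewrite /t/L; lra.
(* The final error is [4 * K * d = e / 2], which together with [t = L + e / 2] gives [L + e]. *)
pose d := e / (8 * K).
have d0 : 0 < d by rewrite divr_gt0// mulr_gt0.
have Kd : K * d = e / 8 by rewrite /d; field; rewrite gt_eqF.
have [N1 H1] := L1 E IE d d0.
have [N2 H2] := L2 d d0.
have [N3 H3] := L3 d d0.
exists (maxn N1 (maxn N2 N3)) => n; rewrite !geq_max => /and3P[n1 n2 n3] A FA.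
have {H1} := H1 n n1 A FA; have {H2} := H2 n n2 A FA.
have {H3} := H3 n n3 A FA.
have ca := @summ A n FA.
have cA : cvgn (series (A n)) by apply: cvg_series_dominated ca.
have cE : cvgn (series (fun k => `|A n k| * \1_E k)).
  apply: cvg_series_dominated ca => k; rewrite normrM normr_id indicE.
  by case: (_ \in _); rewrite /= ?normr1 ?normr0 ?mulr1 ?mulr0.
have cx : cvgn (series (fun k => A n k * x k)).
  apply: (@cvg_series_dominated _ _ (fun k => M * `|A n k|)).
    by move=> k; rewrite normrM mulrC ler_wpM2r.
  exact: is_cvg_seriesZ.
(* Left side minus right side of the termwise inequality, expanded into a linear combination of four
   convergent series. *)
pose h k := A n k * x k + (K - t) * A n k + - K * `|A n k|
  + - K * (`|A n k| * \1_E k).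
have h0 k : h k <= 0.
  have := xM k; rewrite ler_norml => /andP[xl xu].
  have := ler_norm t; have := ler_norm (- t); rewrite normrN => nt1 nt2.
  have yl : 0 <= K + (x k - t) by rewrite /K; lra.
  have yu : 0 <= K - (x k - t) by rewrite /K; lra.
  have Ka : 0 <= K * `|A n k| by rewrite mulr_ge0// ltW.
  have hE : h k = A n k * (x k - t) + K * (A n k - `|A n k|)
      - K * `|A n k| * \1_E k.
    by rewrite /h; ring.
  (* For a nonnegative entry the middle term vanishes: on [E] use [x k - t <= K], off [E] use
     [x k < t]. For a negative entry the middle term is [-2 * K * |A n k|], which absorbs the
     first. *)
  rewrite hE indicE; have [a0|a0] := leP 0 (A n k).
    rewrite ger0_norm// in Ka *; have := mulr_ge0 a0 yu.
    have [tx|tx] := leP t (x k); first by rewrite mem_set//=; lra.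
    rewrite memNset/=; last by rewrite /E /= leNgt tx.
    by have : 0 <= A n k * (t - x k) by [rewrite mulr_ge0//; lra]; lra.
  rewrite ltr0_norm// in Ka *.
  have : 0 <= (- A n k) * (K + (x k - t)) by rewrite mulr_ge0//; lra.
  by case: (_ \in _) => /=; lra.
have ch1 : cvgn (series (fun k => A n k * x k + (K - t) * A n k)).
  exact: cvg_series_lin.
have ch2 : cvgn (series
    (fun k => A n k * x k + (K - t) * A n k + - K * `|A n k|)).
  exact: cvg_series_lin.
have : limn (series h) <= 0.
  apply: limr_le; first exact: cvg_series_lin.
  by apply: nearW => N; apply: sumr_le0.
rewrite /h (lim_series_lin _ ch2 cE) (lim_series_lin _ ch1 ca).
rewrite (lim_series_lin _ cx cA).
rewrite -/(infmx_app A n x).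
set s1 := limn (series (A n)); set s2 := limn (series (fun k => `|A n k|)).
set s3 := limn (series (fun k => `|A n k| * \1_E k)).
rewrite !ler_norml => le0 /andP[_ s2d] /andP[s1d s1d'] /andP[_ s3d].
have K2 : `|t - K| <= 2 * K.
  have := ler_norm t; have := ler_norm (- t); rewrite normrN => nt1 nt2.
  by rewrite ler_norml; apply/andP; split; lra.
(* The summed inequality reads [A_n x <= t + (t - K)(s1 - 1) + K (s2 - 1) + K s3]; the three errors
   are bounded separately. *)
have : (t - K) * (s1 - 1) <= 2 * K * d.
  apply: le_trans (ler_norm _) _; rewrite normrM ler_pM//.
  by rewrite ler_norml s1d.
have : K * (s2 - 1) <= K * d by rewrite ler_pM2l.
have : K * s3 <= K * d by rewrite ler_pM2l// -[s3]subr0.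
have tE : t = L + e / 2 by [].
by clearbody t K d s1 s2 s3; lra.
Qed.

(** * Necessity of (L1)-(L3), by test sequences *)

Hypothesis test : forall x, bounded_fun x ->
  unif_limsup_le Fam (fun A n => infmx_app A n x) (Ilimsup I x).

Lemma limsup_test (x : nat -> R) (c M : R) : (forall k, `|x k| <= M) ->
  I [set k | c < x k] -> unif_limsup_le Fam (fun A n => infmx_app A n x) c.
Proof.
move=> xM Ic e e0; have bx := bounded_by xM.
have [N NP] := test bx e0; exists N => n Nn A FA.
by apply: le_trans (NP n Nn A FA) _; rewrite lerD2r; exact: Ilimsup_le.
Qed.

Lemma ideal_set0 : I set0.
Proof. by apply: (ideal_finite HI); exact: finite_set0. Qed.

Lemma row_sum_cvg1 : unif_lim Fam (fun A n => limn (series (A n))) 1.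
Proof.
move=> e e0.
(* A constant sequence never exceeds its value, so [s = 1] bounds the row sums from above and
   [s = -1] from below. *)
have test1 (s : R) : `|s| <= 1 ->
    unif_limsup_le Fam (fun A n => infmx_app A n (fun=> s)) s.
  move=> s1; apply: (@limsup_test _ _ 1) => [_ //|].
  suff -> : [set _ : nat | s < s] = set0 by exact: ideal_set0.
  by rewrite -subset0 => k /=; rewrite ltxx.
have [|N1 H1] := test1 1 _ e e0; first by rewrite normr1.
have [|N2 H2] := test1 (-1) _ e e0; first by rewrite normrN1.
exists (maxn N1 N2) => n; rewrite geq_max => /andP[n1 n2] A FA.
have cA : cvgn (series (A n)) by apply: cvg_series_dominated (@summ A n FA).
have appE s : infmx_app A n (fun=> s) = s * limn (series (A n)).
  rewrite -[RHS]/(s *: _) -lim_seriesZ//; congr (limn (series _)).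
  by apply/funext => k; exact: mulrC.
have := H1 n n1 A FA; have := H2 n n2 A FA; rewrite !appE.
by rewrite ler_norml => h1 h2; apply/andP; split; lra.
Qed.

Lemma column_cvg0 k : unif_limsup_le Fam (fun A n => `|A n k|) 0.
Proof.
move=> e e0.
(* A multiple of the unit sequence at [k] is positive at most at [k], and finite sets lie in [I];
   the two signs of [s] bound the entry on both sides. *)
have test1 (s : R) : `|s| <= 1 ->
    unif_limsup_le Fam (fun A n => infmx_app A n (fun j => s * (j == k)%:R)) 0.
  move=> s1; apply: (@limsup_test _ _ 1) => [j|].
    by case: (j == k); rewrite ?mulr1 ?mulr0 ?normr0.
  apply: (ideal_sub HI _ (ideal_finite HI (finite_set1 k))) => j /=.
  by case: eqVneq => //= _; rewrite mulr0 ltxx.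
have [|N1 H1] := test1 1 _ e e0; first by rewrite normr1.
have [|N2 H2] := test1 (-1) _ e e0; first by rewrite normrN1.
exists (maxn N1 N2) => n; rewrite geq_max => /andP[n1 n2] A FA.
have appE s : infmx_app A n (fun j => s * (j == k)%:R) = s * A n k.
  apply/cvg_lim => //; apply: cvg_near_cst; exists k.+1 => // N /= kN.
  rewrite big_mkord (bigD1 (Ordinal kN))//= eqxx big1 ?addr0; last first.
    by move=> j jk; rewrite (negbTE jk : (j == k :> nat) = false) !mulr0.
  by rewrite mulr1 mulrC.
have := H1 n n1 A FA; have := H2 n n2 A FA; rewrite !appE.
by rewrite ler_norml => h1 h2; apply/andP; split; lra.
Qed.

(** A sequence supported in [E] is positive only inside [E], which lies in [I], so the gliding hump
    applies with [c = 0]; nonnegativity gives the lower bound. *)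
Lemma ideal_rows_cvg0 E : I E ->
  unif_lim Fam (fun A n => limn (series (fun k => `|A n k| * \1_E k))) 0.
Proof.
move=> IE e e0.
have [x x1 xE|N NP] := gliding_hump summ column_cvg0 (E := E) (c := 0) _ e0.
  apply: (limsup_test x1); apply: (ideal_sub HI _ IE) => k /=.
  by apply: contraPP => /xE ->; rewrite ltxx.
exists N => n Nn A FA; have := NP n Nn A FA; rewrite add0r subr0 => le.
rewrite ger0_norm//; apply: limr_ge.
  apply: cvg_series_dominated (@summ A n FA) => k; rewrite normrM normr_id indicE.
  by case: (_ \in _); rewrite /= ?normr1 ?normr0 ?mulr1 ?mulr0.
apply: nearW => m; apply: sumr_ge0 => k _; rewrite mulr_ge0// indicE.
Qed.

(** The gliding hump with [E] the whole of [nat] gives the upper bound; the lower one follows from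
    (L2), as a row sum is at most the sum of absolute values. *)
Lemma row_norm_cvg1 :
  unif_lim Fam (fun A n => limn (series (fun k => `|A n k|))) 1.
Proof.
move=> e e0; have [N1 H1] := row_sum_cvg1 e0.
have [x x1 _|N2 H2] :=
    gliding_hump summ column_cvg0 (E := setT) (c := 1) _ e0.
  apply: (limsup_test x1); suff -> : [set k | 1 < x k] = set0.
    exact: ideal_set0.
  rewrite -subset0 => k /=; have := x1 k; have := ler_norm (x k); lra.
exists (maxn N1 N2) => n; rewrite geq_max => /andP[n1 n2] A FA.
have := H1 n n1 A FA; have := H2 n n2 A FA.
have -> : (fun k => `|A n k| * \1_[set: nat] k) = (fun k => `|A n k|).
  by apply/funext => k; rewrite indicT mulr1.
have cA : cvgn (series (A n)) by apply: cvg_series_dominated (@summ A n FA).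
have := lim_series_le cA (@summ A n FA) (fun k => ler_norm (A n k)).
by rewrite !ler_norml => h1 h2 /andP[h3 _]; apply/andP; split; lra.
Qed.

End RegularFamily.

Unset Implicit Arguments.

Theorem corollary2p12 (R : realType) (I : set (set nat))
    (Fam : set (nat -> nat -> R))
    (HI : is_ideal I)
    (Fam_neq0 : Fam !=set0)
    (Fam_bnd : (ereal_sup [set infmx_norm A | A in Fam] < +oo)%E) :
  (forall x : nat -> R, bounded_fun x ->
     (limn_esup (fun n => ereal_sup [set (infmx_app A n x)%:E | A in Fam])
        <= (Ilimsup I x)%:E)%E)
  <->
  [/\ forall E : set nat, I E ->
        unif_lim Fam (fun A n => \sum_(k <oo | k \in E) `|A n k|) 0,
      unif_lim Fam (fun A n => \sum_(k <oo) A n k) 1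
    & unif_lim Fam (fun A n => \sum_(k <oo) `|A n k|) 1].
Proof.
have summ A n : Fam A -> cvgn (series (fun k => `|A n k|)).
  move=> FA; apply: infmx_norm_summable; apply: le_lt_trans Fam_bnd.
  by apply: ereal_sup_ubound; exists A.
(* Restricting the summation to [E] is the same as weighting by the indicator, the form in which the
   estimates above are stated. *)
have restrE (E : set nat) :
    (fun (A : nat -> nat -> R) n => \sum_(k <oo | k \in E) `|A n k|) =
    (fun A n => limn (series (fun k => `|A n k| * \1_E k))).
  apply/funext => A; apply/funext => n; congr (limn _); apply/funext => N.
  rewrite big_mkcond; apply: eq_bigr => k _.
  by rewrite indicE; case: (k \in E); rewrite ?mulr1 ?mulr0.
split=> [H|[L1 L2 L3] x bx].
  have {}H x : bounded_fun x ->
      unif_limsup_le Fam (fun A n => infmx_app A n x) (Ilimsup I x).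
    by move=> bx; apply/unif_limsup_leP; exact: H.
  split=> [E IE||]; [|exact: (row_sum_cvg1 HI)|exact: (row_norm_cvg1 HI)].
  by rewrite restrE; exact: (ideal_rows_cvg0 HI).
apply/unif_limsup_leP; apply: limsup_le_of_unif_lim => // E IE.
by rewrite -restrE; exact: L1.
Qed.
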